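(* A connected claw-free graph $G$ has a unique perfect matching if and only if $G\in\mathcal{G}$, where $\mathcal{G}$ is the class of graphs obtained by starting with $K_2$ and iteratively applying the following two operations: Operation 1: add two new vertices $x$ and $y$ and the three new edges $xy$, $xu$, $yu$, where $u$ is a simplicial vertex of the current graph; Operation 2: add two new vertices $x$ and $y$, the new edge $xy$, and new edges between $x$ and all vertices of a set $C$, where $C$ is a non-empty clique of the current graph $H$ such that $N_H(u)\setminus C$ is a clique for every vertex $u\in C$.
   Context: A graph is claw-free if it has no induced $K_{1,3}$. A vertex is simplicial if its neighborhood is a clique. $N_H(u)$ denotes the neighborhood of $u$ in $H$. *)

(* Defs.v *)
From HB Require Import structures.
From mathcomp Require Import all_boot.

Set Implicit Arguments.
Unset Strict Implicit.
Unset Printing Implicit Defensive.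

Record sgraph := SGraph {
  vertex :> finType;
  adj : rel vertex;
  adj_sym : symmetric adj;
  adj_irrefl : irreflexive adj
}.

Definition graph_iso (G H : sgraph) : Prop :=
  exists2 f : G -> H, bijective f & forall u v, adj (f u) (f v) = adj u v.

Definition has_induced (H G : sgraph) : Prop :=
  exists2 f : H -> G, injective f & forall u v, adj (f u) (f v) = adj u v.

Section Complete.
Variable n : nat.

Definition complete_adj : rel 'I_n := fun i j => i != j.

Lemma complete_adj_sym : symmetric complete_adj.
Proof. by move=> i j; rewrite /complete_adj eq_sym. Qed.

Lemma complete_adj_irrefl : irreflexive complete_adj.
Proof. by move=> i; rewrite /complete_adj eqxx. Qed.

Definition complete_graph : sgraph :=
  SGraph complete_adj_sym complete_adj_irrefl.

End Complete.

Section CompleteBipartite.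
Variables m n : nat.

Definition complete_bip_adj : rel ('I_m + 'I_n)%type := fun u v =>
  match u, v with
  | inl _, inr _ | inr _, inl _ => true
  | _, _ => false
  end.

Lemma complete_bip_adj_sym : symmetric complete_bip_adj.
Proof. by case=> i [] j. Qed.

Lemma complete_bip_adj_irrefl : irreflexive complete_bip_adj.
Proof. by case. Qed.

Definition complete_bipartite : sgraph :=
  SGraph complete_bip_adj_sym complete_bip_adj_irrefl.

End CompleteBipartite.

Definition claw_free (G : sgraph) : Prop :=
  ~ has_induced (complete_bipartite 1 3) G.

(* The graph with no vertices is not counted as connected. *)
Definition connected (G : sgraph) : Prop :=
  0 < #|G| /\ forall u v : G, connect (@adj G) u v.

Section Notions.
Variable G : sgraph.

Definition neighborhood (u : G) : {set G} := [set v | adj u v].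

Definition clique (A : {set G}) : Prop :=
  {in A &, forall u v, u != v -> adj u v}.

Definition simplicial (u : G) : Prop := clique (neighborhood u).

Definition is_edge (a : {set G}) : Prop :=
  exists u v, adj u v /\ a = [set u; v].

Definition perfect_matching (M : {set {set G}}) : Prop :=
  [/\ {in M, forall a, is_edge a}, trivIset M & cover M = [set: G]].

Definition has_unique_perfect_matching : Prop :=
  exists! M : {set {set G}}, perfect_matching M.

End Notions.

(* [add_edge A B] adds two new adjacent vertices, x := inr true and
   y := inr false, joining x to all of A and y to all of B. *)
Section AddEdge.
Variables (H : sgraph) (A B : {set H}).

Definition add_edge_adj : rel (H + bool)%type := fun u v =>
  match u, v with
  | inl a, inl b => adj a b
  | inl a, inr z | inr z, inl a => if z then a \in A else a \in B
  | inr z, inr t => z != t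
  end.

Lemma add_edge_adj_sym : symmetric add_edge_adj.
Proof.
by case=> [a|z] [b|t] //=; [apply: adj_sym | rewrite eq_sym].
Qed.

Lemma add_edge_adj_irrefl : irreflexive add_edge_adj.
Proof. by case=> [a|z] /=; [apply: adj_irrefl | rewrite eqxx]. Qed.

Definition add_edge : sgraph := SGraph add_edge_adj_sym add_edge_adj_irrefl.

End AddEdge.

Definition operation1 (H : sgraph) (u : H) : sgraph :=
  add_edge [set u] [set u].

Definition operation2 (H : sgraph) (C : {set H}) : sgraph :=
  add_edge C set0.

(* The class is taken up to isomorphism: [calG_iso] makes membership
   independent of the names of the vertices. *)
Inductive calG : sgraph -> Prop :=
| calG_K2 : calG (complete_graph 2)
| calG_op1 (H : sgraph) (u : H) :
    calG H -> simplicial u -> calG (operation1 u)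
| calG_op2 (H : sgraph) (C : {set H}) :
    calG H -> C != set0 -> clique C ->
    {in C, forall u, clique (neighborhood u :\: C)} ->
    calG (operation2 C)
| calG_iso (G H : sgraph) : calG H -> graph_iso H G -> calG G.

(* Main.v *)
Require Import Defs.
From mathcomp Require Import all_boot.

Set Implicit Arguments.
Unset Strict Implicit.
Unset Printing Implicit Defensive.

(* Fix a perfect matching, viewed as an involution m, and take a longest
   alternating path y_1, m y_1, y_2, m y_2, ..., with adj (m y_i) y_(i+1).
   Since the matching is unique there is no alternating cycle, so every
   neighbour of y_1 other than m y_1 is some y_i with i > 1.  If i > 2, then
   claw-freeness at y_i makes m y_i adjacent to m y_(i-1), and
   y_i, m y_(i-1), ..., m y_1 span an alternating cycle, a contradiction.
   So y_1 is a leaf or is adjacent to y_2; in the latter case m y_1 can be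
   exchanged with y_1 in the path, so y_1, m y_1, y_2 is a pendant triangle.
   Deleting y_1 and m y_1 undoes one of the two operations, and claw-freeness
   gives the clique conditions that the operation requires. *)

(** * Perfect matchings as involutions that move every vertex along an edge *)

Section Mates.
Variable G : sgraph.
Implicit Types (m : G -> G) (M : {set {set G}}).

Definition mate m := involutive m /\ forall v, adj v (m v).

(** Uniqueness is pointwise, since mates are plain functions. *)
Definition unique_mate :=
  exists2 m, mate m & forall m', mate m' -> m' =1 m.

Lemma adj_neq (u v : G) : adj u v -> u != v.
Proof. by apply: contraTneq => ->; rewrite adj_irrefl. Qed.

Definition matching_of_mate m : {set {set G}} := [set [set v; m v] | v : G].

(** The default [v] never occurs for a perfect matching, whose pairs cover every vertex. *)
Definition mate_of_matching M (v : G) : G :=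
  odflt v [pick w | [set v; w] \in M].

Lemma set2_inj (v w w' : G) :
  v != w' -> [set v; w] = [set v; w'] -> w = w'.
Proof.
move=> vw' /setP/(_ w'); rewrite !inE eqxx orbT [w' == v]eq_sym (negbTE vw') /=.
by move/eqP.
Qed.

Lemma matching_of_mateP m : mate m -> perfect_matching (matching_of_mate m).
Proof.
case=> mK adjm; split.
- by move=> a /imsetP[v _ ->]; exists v, (m v).
- apply/trivIsetP => a b /imsetP[v _ ->] /imsetP[w _ ->] vw.
  rewrite -setI_eq0; apply: contraNT vw => /set0Pn[z].
  have pairE t : z \in [set t; m t] -> [set t; m t] = [set z; m z].
    by case/set2P=> ->; rewrite ?mK // setUC.
  by case/setIP=> /pairE-> /pairE->.
- apply/setP=> v; rewrite inE; apply/bigcupP; exists [set v; m v].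
    exact: imset_f.
  by rewrite set21.
Qed.

Lemma mem_mate_of_matching M v :
  perfect_matching M -> [set v; mate_of_matching M v] \in M.
Proof.
case=> edgeM _ covM; rewrite /mate_of_matching; case: pickP => //= noM.
have: v \in cover M by rewrite covM inE.
case/bigcupP=> a aM; case: (edgeM a aM) => u [w [_ a_def]].
move: aM; rewrite a_def => aM /set2P[vE|vE]; first by rewrite -vE noM in aM.
by rewrite -vE setUC noM in aM.
Qed.

Lemma matching_adj M v w : perfect_matching M -> [set v; w] \in M -> adj v w.
Proof.
case=> edgeM _ _ /edgeM[a [b [ab E]]]; have nab := adj_neq ab.
have: (v \in [set a; b]) && (w \in [set a; b]) by rewrite -E set21 set22.
case/andP=> /set2P[] vE /set2P[] wE; rewrite vE wE // in E *.
- by have:= set22 a b; rewrite -E !inE orbb eq_sym (negbTE nab).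
- by rewrite adj_sym.
- by have:= set21 a b; rewrite -E !inE orbb (negbTE nab).
Qed.

(** Two pairs of [M] that share [v] coincide, by disjointness. *)
Lemma matching_mateE M v w :
  perfect_matching M -> [set v; w] \in M -> mate_of_matching M v = w.
Proof.
move=> pM vwM; have vM := mem_mate_of_matching v pM.
have [_ /trivIsetP triv _] := pM.
apply: (@set2_inj v); first exact/adj_neq/(matching_adj pM).
apply/eqP; apply: contraT => /(triv _ _ vM vwM)/pred0P/(_ v).
by rewrite /= !set21.
Qed.

Lemma mate_of_matchingP M : perfect_matching M -> mate (mate_of_matching M).
Proof.
move=> pM; split=> v.
  by apply: matching_mateE => //; rewrite setUC mem_mate_of_matching.
exact/(matching_adj pM)/mem_mate_of_matching.
Qed.

Lemma mate_of_matchingK M :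
  perfect_matching M -> matching_of_mate (mate_of_matching M) = M.
Proof.
move=> pM; apply/setP=> a; apply/imsetP/idP => [[v _ ->]|aM].
  exact: mem_mate_of_matching.
have [edgeM _ _] := pM; have [u [w [_ a_def]]] := edgeM a aM.
by exists u; rewrite // (@matching_mateE _ _ w) -?a_def.
Qed.

Lemma matching_of_mateK m :
  mate m -> mate_of_matching (matching_of_mate m) =1 m.
Proof.
move=> mP v; apply: matching_mateE; first exact: matching_of_mateP.
exact: imset_f.
Qed.

Lemma unique_mateP : has_unique_perfect_matching G <-> unique_mate.
Proof.
split=> [[M [pM uM]]|[m mP um]].
  exists (mate_of_matching M) => [|m mP v]; first exact: mate_of_matchingP.
  by rewrite (uM _ (matching_of_mateP mP)) matching_of_mateK.
exists (matching_of_mate m); split=> [|M pM]; first exact: matching_of_mateP.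
rewrite -[RHS]mate_of_matchingK //.
by apply: eq_imset => v; rewrite (um _ (mate_of_matchingP pM)).
Qed.

End Mates.

(** * Invariance under isomorphism and induced subgraphs *)

Section Isomorphism.

Lemma graph_iso_sym (G H : sgraph) : graph_iso G H -> graph_iso H G.
Proof.
case=> f [g fK gK] fadj; exists g; first by exists f.
by move=> u v; rewrite -fadj !gK.
Qed.

(** Edges may go to paths, even trivial ones, so maps that collapse edges are covered. *)
Lemma connect_homo (S T : finType) (e : rel S) (e' : rel T) (f : S -> T) :
    (forall u v, e u v -> connect e' (f u) (f v)) ->
  forall u v, connect e u v -> connect e' (f u) (f v).
Proof.
move=> fe u v /connectP[p]; elim: p u => [|w p IHp] u /=; first by move=> _ ->.
by case/andP=> /fe/connect_trans euw /IHp IH /IH; apply: euw.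
Qed.

Lemma iso_connected (G H : sgraph) : graph_iso G H -> connected G -> connected H.
Proof.
case=> f fbij fadj [G0 Gc]; split; first by rewrite -(bij_eq_card fbij).
case: fbij => g fK gK u v; rewrite -(gK u) -(gK v).
apply: connect_homo (Gc _ _) => a b ab.
by apply: connect1; rewrite fadj.
Qed.

Lemma induced_claw_free (G H : sgraph) :
  has_induced H G -> claw_free G -> claw_free H.
Proof.
case=> f finj fadj cG [g ginj gadj]; apply: cG; exists (f \o g).
  exact: inj_comp.
by move=> u v; rewrite /= fadj gadj.
Qed.

Lemma iso_induced (G H : sgraph) : graph_iso G H -> has_induced G H.
Proof. by case=> f /bij_inj finj fadj; exists f. Qed.

Lemma iso_unique_mate (G H : sgraph) :
  graph_iso G H -> unique_mate G -> unique_mate H.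
Proof.
case=> f [g fK gK] fadj [m [mK madj] um].
exists (f \o m \o g).
  split=> [v|v]; first by rewrite /= fK mK gK.
  by rewrite -{1}(gK v) /= fadj.
move=> m' [m'K m'adj] v /=; rewrite -(um (g \o m' \o f)) /= ?gK //.
by split=> w /=; [rewrite gK m'K fK | rewrite -fadj gK].
Qed.

End Isomorphism.

(** * Attaching a new edge to a graph *)

Section AddEdgeTheory.
Variables (H : sgraph) (A B : {set H}).

Lemma card_add_edge : #|add_edge A B| = #|H| + 2.
Proof. by rewrite card_sum card_bool. Qed.

Lemma add_edge_induced : has_induced H (add_edge A B).
Proof. by exists inl => // u v [->]. Qed.

(** When the new vertices are always matched together, restriction to [H] and extension from [H] are
    inverse passages between mates. *)
Lemma add_edge_unique_mate :
    (forall m : add_edge A B -> add_edge A B,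
       mate m -> m (inr true) = inr false) ->
  unique_mate (add_edge A B) <-> unique_mate H.
Proof.
move=> new_edge.
pose lift (h : H -> H) : add_edge A B -> add_edge A B :=
  fun v => match v with inl a => inl (h a) | inr z => inr (~~ z) end.
(* The value [a] is a dummy: a mate that pairs the new vertices sends old vertices to old ones. *)
pose restr (m : add_edge A B -> add_edge A B) (a : H) :=
  if m (inl a) is inl b then b else a.
have liftP h : mate h -> mate (lift h).
  by case=> hK hadj; split=> [[a|[]]|[a|[]]] //=; rewrite hK.
have lift_restr m : mate m -> lift (restr m) =1 m.
  move=> mP; have [mK _] := mP; have mt := new_edge m mP.
  case=> [a|[]] //=; last by rewrite -mt mK.
  rewrite /restr; case E: (m (inl a)) => [b|[]] //.
    by have:= mK (inl a); rewrite E mt.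
  by have:= mK (inl a); rewrite E -mt mK.
have restrP m : mate m -> mate (restr m).
  move=> mP; have E := lift_restr m mP; have [mK madj] := mP; split=> a.
    by have := mK (inl a); rewrite -!E => -[].
  by have := madj (inl a); rewrite -E.
split=> [[m mP um]|[h hP uh]].
  exists (restr m) => [|h hP a]; first exact: restrP.
  by have:= um _ (liftP h hP) (inl a); rewrite -(lift_restr m mP) => -[].
exists (lift h) => [|m mP v]; first exact: liftP.
by rewrite -(lift_restr m mP); case: v => //= a; rewrite (uh _ (restrP m mP)).
Qed.

(** Retracting the new vertices onto [u0] turns every edge into a path of [H]. *)
Lemma add_edge_connected (u0 : H) :
    {in A :|: B, forall w, (w == u0) || adj w u0} ->
  connected (add_edge A B) -> connected H.
Proof.
move=> near_u0 [_ Gc]; split; first by apply/card_gt0P; exists u0.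
pose g (v : add_edge A B) := if v is inl a then a else u0.
have step w (z : bool) : w \in (if z then A else B) -> connect (@adj H) w u0.
  move=> wz; have /near_u0/orP[/eqP->|/connect1//] : w \in A :|: B.
    by rewrite inE; case: z wz => ->; rewrite ?orbT.
  exact: connect0.
move=> a b; apply: (@connect_homo _ _ (@adj (add_edge A B)) _ g _ (inl a) (inl b)) => //.
have csym : connect_sym (@adj H) by apply: sym_connect_sym; apply: adj_sym.
case=> [v|z] [w|t] //=; first exact: connect1.
- by case: t => [/(step _ true)|/(step _ false)].
- by rewrite csym; case: z => [/(step _ true)|/(step _ false)].
Qed.

End AddEdgeTheory.

(** Otherwise the four vertices span a claw; adjacency already makes [c] distinct from the
    leaves. *)
Lemma claw_freeP (G : sgraph) (c a1 a2 a3 : G) :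
    claw_free G -> adj c a1 -> adj c a2 -> adj c a3 ->
    a1 != a2 -> a1 != a3 -> a2 != a3 ->
  [|| adj a1 a2, adj a1 a3 | adj a2 a3].
Proof.
move=> cG c1 c2 c3 n12 n13 n23; apply: contraT.
rewrite !negb_or => /and3P[/negbTE e12 /negbTE e13 /negbTE e23].
case: cG; pose f (v : complete_bipartite 1 3) : G :=
  match v with inl _ => c | inr i => nth c [:: a1; a2; a3] i end.
have c1' := adj_neq c1; have c2' := adj_neq c2; have c3' := adj_neq c3.
have fadj u v : adj (f u) (f v) = adj u v.
  case: u v => [i|[[|[|[|//]]] ?]] [j|[[|[|[|//]]] ?]] /=;
    by rewrite ?adj_irrefl ?c1 ?c2 ?c3 ?e12 ?e13 ?e23 // adj_sym
               ?c1 ?c2 ?c3 ?e12 ?e13 ?e23.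
exists f => //.
case=> [i|[[|[|[|//]]] ?]] [j|[[|[|[|//]]] ?]] /= /eqP;
  rewrite ?(negbTE c1') ?(negbTE c2') ?(negbTE c3') ?(negbTE n12)
          ?(negbTE n13) ?(negbTE n23) // 1?eq_sym
          ?(negbTE c1') ?(negbTE c2') ?(negbTE c3') ?(negbTE n12)
          ?(negbTE n13) ?(negbTE n23) // => _;
  first (by rewrite !ord1); by congr inr; apply: val_inj.
Qed.

(** * The two operations and the conditions forced by claw-freeness *)

Section Operations.
Variable H : sgraph.

(** Each new vertex has only the other one and [u] as neighbours; if one were matched to [u], so
    would be the other, against injectivity. *)
Lemma operation1_unique_mate (u : H) :
  unique_mate (operation1 u) <-> unique_mate H.
Proof.
apply: add_edge_unique_mate => m [mK madj].
have:= madj (inr true); have:= madj (inr false).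
case E1: (m (inr true)) => [a|[]] //; case E2: (m (inr false)) => [b|[]] //=.
  move=> /set1P bu /set1P au.
  by have := mK (inr true); rewrite E1 au -bu -E2 mK.
by have := mK (inr false); rewrite E2 E1.
Qed.

(** The vertex [inr false] is a leaf, so its mate is forced. *)
Lemma operation2_unique_mate (C : {set H}) :
  unique_mate (operation2 C) <-> unique_mate H.
Proof.
apply: add_edge_unique_mate => m [mK madj].
have:= madj (inr false); case E: (m (inr false)) => [a|[]] //=.
  by rewrite inE.
by rewrite -E mK.
Qed.

(** Two nonadjacent neighbours of [u] would form a claw at [u] with [inr true]. *)
Lemma operation1_simplicial (u : H) : claw_free (operation1 u) -> simplicial u.
Proof.
move=> cf v w; rewrite !inE => uv uw vw.
have := @claw_freeP (operation1 u) (inl u) (inr true) (inl v) (inl w) cf.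
rewrite /= set11 !inE => /(_ isT uv uw isT isT vw).
by rewrite !(eq_sym _ u) (negbTE (adj_neq uv)) (negbTE (adj_neq uw)).
Qed.

(** A claw at [inr true] with the leaf [inr false] is excluded. *)
Lemma operation2_clique (C : {set H}) : claw_free (operation2 C) -> clique C.
Proof.
move=> cf v w vC wC vw.
have := @claw_freeP (operation2 C) (inr true) (inr false) (inl v) (inl w) cf.
by rewrite /= !inE => /(_ isT vC wC isT isT vw).
Qed.

(** A claw at [u] is excluded; its third leaf would be [inr true], which sees nothing of [H] outside
    [C]. *)
Lemma operation2_clique_setD (C : {set H}) :
  claw_free (operation2 C) -> {in C, forall u, clique (neighborhood u :\: C)}.
Proof.
move=> cf u uC v w; rewrite !inE => /andP[vC uv] /andP[wC uw] vw.
have := @claw_freeP (operation2 C) (inl u) (inr true) (inl v) (inl w) cf.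
by rewrite /= (negbTE vC) (negbTE wC) => /(_ uC uv uw isT isT vw).
Qed.

Lemma operation1_connected (u : H) : connected (operation1 u) -> connected H.
Proof.
by apply: (@add_edge_connected _ _ _ u) => w; rewrite !inE orbb => ->.
Qed.

Lemma operation2_connected (C : {set H}) :
  C != set0 -> clique C -> connected (operation2 C) -> connected H.
Proof.
case/set0Pn=> u uC cC; apply: (@add_edge_connected _ _ _ u) => w.
by rewrite setU0 => wC; case: eqVneq => //= wu; apply: cC.
Qed.

(** With empty [C] the new edge is a component of its own, so [H] must be empty. *)
Lemma operation2_set0 : connected (operation2 (set0 : {set H})) ->
  graph_iso (complete_graph 2) (operation2 (set0 : {set H})).
Proof.
move=> [_ Gc].
(* Sending [H] to [true] and the new vertices to [false] is constant along edges, so a path from [a]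
   to a new vertex would identify the two booleans. *)
have H0 (a : H) : False.
  have Gt := @connect_homo _ bool (@adj (operation2 (set0 : {set H}))) eq_op
    (fun v => if v is inl _ then true else false).
  have : connect eq_op true false.
    apply: (Gt _ (inl a) (inr true)) => // -[v|z] [w|t] //=;
      rewrite ?connect0 // inE; by case: ifP.
  case/connectP=> p; elim: p => //= -[] p IHp //=.
exists (fun i : complete_graph 2 => inr (i == ord0) : operation2 (set0 : {set H})).
  exists (fun v : operation2 (set0 : {set H}) =>
     if v is inr true then ord0 else ord_max).
    by case=> [[|[|//]] ?]; apply: val_inj.
  by case=> [a|[]] //; case: (H0 a).
by case=> [[|[|//]] ?] [[|[|//]] ?].
Qed.

End Operations.

(** * Deletion of two vertices, and its reversal *)

Section Deletion.
Variables (G : sgraph) (x y : G).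

Definition remaining := {v : G | (v != x) && (v != y)}.

Definition delete_adj : rel remaining := fun a b => adj (val a) (val b).

Lemma delete_adj_sym : symmetric delete_adj.
Proof. by move=> a b; apply: adj_sym. Qed.

Lemma delete_adj_irrefl : irreflexive delete_adj.
Proof. by move=> a; apply: adj_irrefl. Qed.

Definition delete : sgraph := SGraph delete_adj_sym delete_adj_irrefl.

Definition deleted_nbrs (z : G) : {set delete} :=
  [set a : remaining | adj z (val a)].

Lemma add_edge_delete_iso :
  adj x y -> graph_iso (add_edge (deleted_nbrs x) (deleted_nbrs y)) G.
Proof.
move=> xy; have nxy := adj_neq xy.
pose f (v : add_edge (deleted_nbrs x) (deleted_nbrs y)) : G :=
  match v with inl a => val (a : remaining) | inr z => if z then x else y end.
have nval (a : remaining) : (val a == x = false) * (val a == y = false).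
  by case: a => a /= /andP[/negbTE-> /negbTE->].
exists f.
  apply: inj_card_bij.
    case=> [a|[]] [b|[]] //= /eqP; rewrite ?(eq_sym x) ?(eq_sym y) ?nval //.
    - by move/eqP/val_inj->.
    - by rewrite (negbTE nxy).
    - by rewrite (negbTE nxy).
  rewrite card_add_edge card_sig -(cardC [pred v | (v != x) && (v != y)]).
  rewrite leq_add2l (@eq_card _ _ [set x; y]) ?cards2 ?nxy // => v.
  by rewrite !inE negb_and !negbK.
case=> [a|[]] [b|[]] //=; rewrite ?inE ?adj_irrefl // adj_sym ?xy //.
Qed.

End Deletion.

(** * Alternating cycles and longest alternating paths *)

Section AlternatingPaths.
Variables (G : sgraph) (m : G -> G).
Hypothesis mP : mate m.
Hypothesis m_unique : forall m', mate m' -> m' =1 m.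

Let mK : involutive m := mP.1.
Let madj : forall v, adj v (m v) := mP.2.

(* A list [y1; y2; ...] encodes the alternating walk y1, m y1, y2, m y2, ... *)
Definition alt : rel G := fun a b => adj (m a) b.

(** At most one end of each matching edge is listed, and only once: the encoded walk visits no
    vertex twice. *)
Definition transversal (s : seq G) :=
  uniq s && all (fun v => m v \notin s) s.

Lemma transversalP s :
  reflect (uniq s /\ forall v, v \in s -> m v \notin s) (transversal s).
Proof. by apply: (iffP andP) => -[us /allP]. Qed.

(* One vertex per matching edge is listed, so the cycle below is alternating
   in G; rematching m a with next s a along it yields a second mate. *)
Lemma no_alternating_cycle s :
  transversal s -> cycle alt s -> size s <= 1.
Proof.
case/transversalP=> us ms cs.
pose m' v := if v \in s then m (prev s v)
             else if m v \in s then next s (m v) else m v.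
have m'P : mate m'.
  split=> v; rewrite /m'.
    case vs: (v \in s) => /=.
      rewrite (negbTE (ms _ _)) ?mem_prev // mK mem_prev vs.
      by rewrite next_prev.
    case mvs: (m v \in s); first by rewrite mem_next mvs prev_next.
    by rewrite mvs mK vs.
  case vs: (v \in s); first by rewrite adj_sym; exact: (prev_cycle cs vs).
  case mvs: (m v \in s); last exact: madj.
  by have:= next_cycle cs mvs; rewrite /alt mK.
case: s us @m' m'P {ms cs} => [|a [|b s]] // us m' m'P; exfalso.
(* Agreement of [m'] and [m] at [a] would make [a] its own predecessor on the cycle, hence equal to
   [b]. *)
have /(congr1 m) := m_unique m'P a.
rewrite /m' mem_head !mK => /(congr1 (next [:: a, b & s])).
rewrite next_prev //= eqxx => /eqP; move: us.
by rewrite /= inE negb_or eq_sym -andbA => /and3P[/negbTE->].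
Qed.

Definition alt_path s := sorted alt s && transversal s.

(** Lengths are bounded by [#|G|], and the singleton [[:: v]] shows that a longest path is
    nonempty. *)
Lemma longest_alt_path (v : G) : exists y p,
  alt_path (y :: p) /\ forall s, alt_path s -> size s <= size (y :: p).
Proof.
pose P n := [exists t : n.-tuple G, alt_path t].
have exP : exists n, P n.
  exists 1; apply/existsP; exists [tuple v].
  rewrite /alt_path /transversal /= andbT inE.
  by rewrite eq_sym (adj_neq (madj v)).
have leP n : P n -> n <= #|G|.
  case/existsP=> t /andP[_ /andP[/card_uniqP ut _]].
  by rewrite -(size_tuple t) -ut max_card.
case: (ex_maxnP exP leP) => n /existsP[t tP] maxn.
have maxt s : alt_path s -> size s <= size t.
  by move=> sP; rewrite size_tuple; apply: maxn; apply/existsP; exists (in_tuple s).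
case: (tval t) tP maxt => [|y p] tP maxt; last by exists y, p.
have /maxt // : alt_path [:: v].
rewrite /alt_path /transversal /= andbT inE.
by rewrite eq_sym (adj_neq (madj v)).
Qed.

Hypothesis G_claw_free : claw_free G.

(** A neighbour off the path would extend it at the front; one beyond the head of [p] is excluded by
    claw-freeness. *)
Lemma longest_alt_path_nbrs y p :
    alt_path (y :: p) ->
    (forall s, alt_path s -> size s <= size (y :: p)) ->
  forall v, adj y v -> v = m y \/ exists q, p = v :: q.
Proof.
case/andP=> /= pp tp maxp v yv.
have [up mp] := transversalP _ tp.
(* An edge from [m w] to [y] would close the path up to [w] into an alternating cycle. *)
have no_back w : w \in p -> ~~ adj y (m w).
  move=> wp; apply/negP=> yw.
  case/path.splitP: wp pp up mp {maxp tp} => p1 p2 pp up mp.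
  have: size (y :: rcons p1 w) <= 1; last by rewrite /= size_rcons.
  move: pp; rewrite cat_path => /andP[pp _].
  apply: no_alternating_cycle; last first.
    rewrite /= rcons_path pp last_rcons /alt adj_sym; exact: yw.
  have sub : {subset y :: rcons p1 w <= y :: rcons p1 w ++ p2}.
    by move=> t; rewrite -cat_cons mem_cat => ->.
  apply/transversalP; split.
    by move: up; rewrite -cat_cons cat_uniq => /andP[].
  by move=> t /sub/mp; apply: contra; apply: sub.
have [vp|vp] := boolP (v \in p); last first.
  case: (eqVneq v (m y)) => [|vmy]; [by left|].
  have [mvp|mvp] := boolP (m v \in p).
    by have := no_back _ mvp; rewrite mK yv.
  have vy : v != y by rewrite eq_sym (adj_neq yv).
  have mvy : m v != y by apply: contra vmy => /eqP <-; rewrite mK.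
  (* The path can be prolonged by [m v] because [m (m v) = v] is adjacent to [y]. *)
  have /maxp : alt_path [:: m v, y & p]; last by rewrite /= ltnn.
  rewrite /alt_path /= pp andbT {1}/alt mK adj_sym yv /=.
  apply/transversalP; split.
    by move: up => /= ->; rewrite inE negb_or mvy mvp.
  move=> t; rewrite inE => /predU1P[->|tp'].
    rewrite mK !inE !negb_or vy vp !andbT; exact/adj_neq/madj.
  rewrite inE negb_or mp // andbT (inj_eq (can_inj mK)).
  by apply: contraTneq tp' => ->; rewrite inE negb_or vy vp.
right; case/splitPr: vp pp up mp no_back {tp maxp} => p1 p2.
case/lastP: p1 => [|p1 a]; first by exists p2.
(* Here [v] is not the head of [p], and [a] is the entry of [p] just before it. *)
rewrite cat_path [path _ _ (v :: _)]/= last_rcons => /and3P[pp av _] up mp no_back; exfalso.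
have ap : a \in rcons p1 a ++ v :: p2 by rewrite mem_cat mem_rcons mem_head.
have vp : v \in rcons p1 a ++ v :: p2 by rewrite mem_cat mem_head orbT.
set s := y :: rcons p1 a.
have subs t : t \in s -> t \in y :: rcons p1 a ++ v :: p2.
  by rewrite -cat_cons mem_cat => ->.
have vs : v \notin s.
  move: up; rewrite -cat_cons cat_uniq => /and3P[_ /=].
  by rewrite negb_or => /andP[].
have us : uniq s by move: up; rewrite -cat_cons cat_uniq => /andP[].
(* Among the neighbours [y], [m v], [m a] of [v], the fact [no_back] leaves only this adjacency. *)
have mvma : adj (m v) (m a).
  have ya := no_back _ ap; have yv' := no_back _ vp.
  have := @claw_freeP G v y (m v) (m a) G_claw_free.
  rewrite (negbTE ya) (negbTE yv') /=; apply.
  - by rewrite adj_sym.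
  - exact: madj.
  - by rewrite adj_sym.
  - apply: contraNneq (mp v _) => [<-|]; first exact: mem_head.
    by rewrite inE vp orbT.
  - apply: contraNneq (mp a _) => [<-|]; first exact: mem_head.
    by rewrite inE ap orbT.
  - rewrite (inj_eq (can_inj mK)); apply: contraNneq vs => ->.
    by rewrite inE mem_rcons mem_head orbT.
(* The initial segment of the path up to v, traversed backwards. *)
have: size (rev (v :: map m s)) <= 1.
  apply: no_alternating_cycle; last first.
    (* Besides reversed path edges, the cycle uses the edge from [y] to [v] and the edge from [m v]
       to [m a]. *)
    rewrite rev_cycle /= rcons_path /= map_rcons last_rcons.
    rewrite {1}/alt mK yv /= {2}/alt mvma andbT -map_rcons path_map.
    apply: sub_path pp => b c; rewrite /alt /= mK adj_sym //.
  apply/transversalP; split.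
    rewrite rev_uniq cons_uniq (map_inj_uniq (can_inj mK)) us andbT.
    apply/mapP=> -[b bs vE]; have := mp _ (subs b bs).
    by rewrite -vE inE vp orbT.
  move=> t; rewrite !mem_rev !(in_cons v) negb_or => /predU1P[->|/mapP[b bs ->]].
    by rewrite eq_sym (adj_neq (madj v)) mem_map //; apply: can_inj mK.
  rewrite mK; apply/andP; split; first by apply: contraNneq vs => <-.
  apply/mapP=> -[c cs bE]; have := mp _ (subs c cs).
  by rewrite -bE subs.
by rewrite size_rev /= size_map size_rcons.
Qed.

(** The description of neighbours is applied at [y] and, if [y] is not a leaf, also at [m y]. *)
Lemma leaf_or_pendant_triangle (v : G) :
  (exists x y : G, adj x y /\ forall w, adj y w -> w = x) \/
  (exists x y u : G, [/\ adj x y, adj x u, adj y u,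
     forall w, adj x w -> w = y \/ w = u & forall w, adj y w -> w = x \/ w = u]).
Proof.
have [y [p [yp maxp]]] := longest_alt_path v.
have nbrs := longest_alt_path_nbrs yp maxp.
have [/existsP[u /andP[yu umy]]|no_u] := boolP [exists u, adj y u && (u != m y)];
  last first.
  left; exists (m y), y; split; first by rewrite adj_sym.
  move=> w yw; apply/eqP; apply: contraNT no_u => wmy.
  by apply/existsP; exists w; rewrite yw.
right; exists (m y), y, u.
have [q p_def] : exists q, p = u :: q.
  by case: (nbrs u yu) => // uE; rewrite uE eqxx in umy.
rewrite {p}p_def in yp maxp nbrs.
have [/= /andP[myu uq] /transversalP[/= /andP[yuq uuq] mp]] := andP yp.
(* Exchanging [y] with [m y] keeps the length and uses the edge from [y] to [u], so this path is
   longest too. *)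
have yp' : alt_path [:: m y, u & q].
  rewrite /alt_path /= {1}/alt mK yu uq /=; apply/transversalP; split.
    by have := mp y (mem_head _ _); rewrite /= uuq inE negb_or => /andP[_ ->].
  move=> t; rewrite inE => /predU1P[->|tq].
    by rewrite mK inE negb_or yuq (adj_neq (madj y)).
  rewrite inE negb_or (inj_eq (can_inj mK)); apply/andP; split.
    by apply: contraNneq yuq => <-.
  by have := mp t; rewrite in_cons tq orbT in_cons negb_or => /(_ isT)/andP[].
have nbrs' := longest_alt_path_nbrs yp' maxp.
split=> //; first by rewrite adj_sym.
  by move=> w /nbrs'[->|[r [-> _]]]; [left; rewrite mK|right].
by move=> w /nbrs[->|[r [-> _]]]; [left|right].
Qed.

End AlternatingPaths.

(** * The two directions of the equivalence *)

Lemma calG_unique_mate (G : sgraph) : calG G -> unique_mate G.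
Proof.
elim=> {G} [|H u _ IH _|H C _ IH _ _ _|G H _ IH iso].
- pose m (i : complete_graph 2) : complete_graph 2 := if i == ord0 then ord_max else ord0.
  exists m; first by split=> -[[|[|//]] ?]; rewrite /m //; apply: val_inj.
  move=> m' [_ madj] i; have := madj i; rewrite /m.
  case: i => [[|[|//]] ?]; case: (m' _) => [[|[|//]] ?] //= _; exact: val_inj.
- exact/operation1_unique_mate.
- exact/operation2_unique_mate.
- exact: iso_unique_mate iso IH.
Qed.

(** The side conditions of the operations are left open here, and [C] may be empty; claw-freeness of
    [G] supplies the conditions afterwards. *)
Lemma iso_operation (G : sgraph) :
    0 < #|G| -> claw_free G -> unique_mate G ->
  (exists (H : sgraph) (u : H), graph_iso (operation1 u) G) \/
  (exists (H : sgraph) (C : {set H}), graph_iso (operation2 C) G).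
Proof.
case/card_gt0P=> v _ cf [m mP um].
case: (leaf_or_pendant_triangle mP um cf v).
  (* For a leaf [y], the set [C] consists of the other neighbours of [x]. *)
  case=> x [y [xy yx]]; right; exists (delete x y), (deleted_nbrs x y x).
  have := add_edge_delete_iso xy; congr (graph_iso (add_edge _ _) _).
  apply/setP=> a; rewrite !inE; apply/negP=> /yx ax.
  by have /andP[/eqP ? /eqP ?] := valP (a : remaining x y).
case=> x [y [u [xy xu yu Nx Ny]]]; left.
have u_rem : (u != x) && (u != y) by rewrite !(eq_sym u) !adj_neq.
exists (delete x y), (Sub u u_rem : remaining x y).
have := add_edge_delete_iso xy; congr (graph_iso (add_edge _ _) _).
  apply/setP=> a; rewrite !inE -(inj_eq val_inj) /=.
  apply/idP/eqP=> [/Nx[]// aE|->//].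
  by have /andP[/eqP ? /eqP ?] := valP (a : remaining x y).
apply/setP=> a; rewrite !inE -(inj_eq val_inj) /=.
apply/idP/eqP=> [/Ny[]// aE|->//].
by have /andP[/eqP ? /eqP ?] := valP (a : remaining x y).
Qed.

(** Strong induction on the number of vertices: undoing the last operation preserves all three
    hypotheses, unless [H] is empty. *)
Lemma unique_mate_calG (G : sgraph) :
  connected G -> claw_free G -> unique_mate G -> calG G.
Proof.
have [n] := ubnP #|G|; elim: n G => // n IHn G ltGn Gc Gcf Gu.
have smaller (H : sgraph) (A B : {set H}) : graph_iso (add_edge A B) G -> #|H| < n.
  case=> f /bij_eq_card; rewrite card_add_edge addn2 => E _.
  by rewrite -E ltnS in ltGn; apply: ltnW.
case: (iso_operation Gc.1 Gcf Gu) => [[H [u iso]]|[H [C iso]]].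
all: have Hn := smaller _ _ _ iso; apply: (calG_iso _ iso).
all: have iso' := graph_iso_sym iso.
all: have Oc := iso_connected iso' Gc; have Ou := iso_unique_mate iso' Gu.
all: have Ocf := induced_claw_free (iso_induced iso) Gcf.
all: have Hcf := induced_claw_free (add_edge_induced _ _) Ocf.
  apply: calG_op1; last exact: operation1_simplicial.
  apply: IHn => //; first exact: operation1_connected Oc.
  exact/operation1_unique_mate/Ou.
have cC := operation2_clique Ocf.
(* An empty [C] means that [G] is a single edge, the starting graph of the class. *)
have [C0|C0] := eqVneq C set0.
  by rewrite C0 in Oc *; apply: calG_iso calG_K2 (operation2_set0 Oc).
apply: calG_op2 => //; last exact: operation2_clique_setD.
apply: IHn => //; first exact: operation2_connected Oc.
exact/operation2_unique_mate/Ou.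
Qed.

Theorem theorem5 (G : sgraph) (G_connected : connected G)
    (G_claw_free : claw_free G) :
  has_unique_perfect_matching G <-> calG G.
Proof.
split=> [/unique_mateP|/calG_unique_mate uG]; last exact/unique_mateP.
exact: unique_mate_calG.
Qed.
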